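(* Let $s$ be a positive integer and let $\Phi:\mathbb{R}^{n\times n}\to\mathbb{R}^m$ be a linear operator. Suppose there exist positive constants $0<\delta_s<1$ and $\Delta_s>0$ such that: (1) $(1-\delta_s)|Z|_F^2\le|\Phi(Z)|_2^2\le(1+\delta_s)|Z|_F^2$ for every $Z\in\Sigma_s^{n\times n}$; (2) $|\langle\Phi(Z),\Phi(W)\rangle|\le\dfrac{\Delta_s}{n}\sum_{j=1}^n|z_j|_2|w_j|_2$ for all $Z=(z_1,\dots,z_n)\in\Sigma_s^{n\times n}$ and $W=(w_1,\dots,w_n)\in\Sigma_s^{n\times n}$ with $\mathrm{supp}(Z)\cap\mathrm{supp}(W)=\emptyset$. Then there are constants $\rho$ and $\beta$ such that $$|||H_S|||_1\le\rho\,|||H_{\sim S}|||_1+\beta|\Phi(H)|_2$$ for every $n\times n$ matrix $H$ and every $s$-sparsity pattern $S$, where the constants can be selected such that $$\rho\le\frac{\Delta_s}{1-\delta_s-\Delta_s/4},\qquad\beta\le\frac{s^{1/2}(1+\delta_s)^{1/2}}{1-\delta_s-\Delta_s/4}.$$ In particular, $\delta_s+5\Delta_s/4<1$ implies that the inequality $|||H_S|||_1\le\rho\,|||H_{\sim S}|||_1+\beta|\Phi(H)|_2$ holds for every $n\times n$ matrix $H$ and every $s$-sparsity pattern $S$ with constants $\rho$ and $\beta$ satisfying these bounds and with $\rho<1$ (the robust null space condition).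
   Context: For $Z=(z_1,\dots,z_n)\in\mathbb{R}^{n\times n}$ with columns $z_j$, $|||Z|||_1:=\max_j|z_j|_1$ ($|\cdot|_1$ the vector $l_1$-norm); $|\cdot|_2$ is the Euclidean norm and $|\cdot|_F$ the Frobenius norm. $\Sigma_s^{n\times n}$ is the set of $n\times n$ real matrices each of whose columns has at most $s$ nonzero entries; $\mathrm{supp}(Z)$ is the set of index pairs of nonzero entries. An $s$-sparsity pattern is a set $S=S_1\cup\dots\cup S_n$ with $S_j\subseteq\{(i,j):i=1,\dots,n\}$ and $|S_j|\le s$ for each $j$; $\sim S$ is its complement in $\{(i,j):1\le i,j\le n\}$. $H_T$ agrees with $H$ on entries in $T$ and is zero elsewhere.
   Formalization: The bounds on ρ and β in the first part are asserted only when 1−δ_s−Δ_s/4 > 0; for a negative denominator they would force β < 0, which fails for H supported in S, and at zero they are undefined. Existence of ρ and β is still claimed in every case. *)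

(* Defs.v *)
From HB Require Import structures.
From mathcomp Require Import all_boot all_order all_algebra.
From mathcomp Require Import reals.

Set Implicit Arguments.
Unset Strict Implicit.
Unset Printing Implicit Defensive.

Import Order.TTheory GRing.Theory Num.Theory.
Local Open Scope ring_scope.

Definition norm1 (R : realType) (k : nat) (x : 'cV[R]_k) : R :=
  \sum_i `|x i 0|.

Definition inner (R : realType) (k : nat) (x y : 'cV[R]_k) : R :=
  \sum_i x i 0 * y i 0.

Definition norm2 (R : realType) (k : nat) (x : 'cV[R]_k) : R :=
  Num.sqrt (\sum_i x i 0 ^+ 2).

Definition normF (R : realType) (n : nat) (Z : 'M[R]_n) : R :=
  Num.sqrt (\sum_i \sum_j Z i j ^+ 2).

(* The neutral element 0 is harmless: the l1-norms of the columns are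
   nonnegative. *)
Definition maxcol_norm1 (R : realType) (n : nat) (Z : 'M[R]_n) : R :=
  \big[Num.max/0]_j norm1 (col j Z).

Definition supp (R : realType) (n : nat) (Z : 'M[R]_n) : {set 'I_n * 'I_n} :=
  [set p | Z p.1 p.2 != 0].

Definition col_sparse (R : realType) (s n : nat) (Z : 'M[R]_n) : Prop :=
  forall j : 'I_n, (#|[set i : 'I_n | Z i j != 0%R]| <= s)%N.

Definition sparsity_pattern (s n : nat) (S : {set 'I_n * 'I_n}) : Prop :=
  forall j : 'I_n, (#|[set i : 'I_n | (i, j) \in S]| <= s)%N.

Definition restrict_mx (R : realType) (n : nat) (T : {set 'I_n * 'I_n})
    (H : 'M[R]_n) : 'M[R]_n :=
  \matrix_(i, j) (if (i, j) \in T then H i j else 0).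

Definition null_space_ineq (R : realType) (s n m : nat)
    (Phi : 'M[R]_n -> 'cV[R]_m) (rho beta : R) : Prop :=
  forall (H : 'M[R]_n) (S : {set 'I_n * 'I_n}), sparsity_pattern s S ->
    maxcol_norm1 (restrict_mx S H)
      <= rho * maxcol_norm1 (restrict_mx (~: S) H) + beta * norm2 (Phi H).

(* Main.v *)
(* Hypothesis (2) makes the images of matrices supported on disjoint columns
   orthogonal, so the problem splits into one compressed sensing problem per
   column.  In a column, replace S by the set T of its s largest entries, and
   cut the remaining entries into blocks of s entries of decreasing modulus.
   By (1) and (2), with h the column and Phi(h_T) = Phi(H) - Phi(H - h_T),
     (1 - delta) |h_T|_2
       <= sqrt(1 + delta) |Phi(H)|_2 + Delta * (sum of the l2-norms of the blocks),
   and the sum is at most |h_(~T)|_1 / sqrt s + |h_T|_2 / 4.  If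
   1 - delta - Delta / 4 <= 0, blocks of single entries still give some
   (larger) constants. *)
Require Import Defs.
From HB Require Import structures.
From mathcomp Require Import all_boot all_order all_algebra.
From mathcomp Require Import reals ring lra.

Set Implicit Arguments.
Unset Strict Implicit.
Unset Printing Implicit Defensive.

Import Order.TTheory GRing.Theory Num.Theory.
Local Open Scope ring_scope.

(** * Finite sums: Cauchy-Schwarz, largest terms, decomposition into blocks *)

Lemma sum_CauchySchwarz (R : realDomainType) (I : finType) (P : pred I)
    (x y : I -> R) :
  (\sum_(i | P i) x i * y i) ^+ 2
    <= (\sum_(i | P i) x i ^+ 2) * (\sum_(i | P i) y i ^+ 2).
Proof.
set p := \sum_(i | P i) _; set X := \sum_(i | P i) _; set Y := \sum_(i | P i) _.
have Y_ge0 : 0 <= Y by apply: sumr_ge0 => i _; apply: sqr_ge0.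
have [Y0 | Y_neq0] := eqVneq Y 0.
  have y0 i : P i -> y i = 0.
    move=> Pi; apply/eqP; rewrite -(sqrf_eq0 (y i)); apply/eqP.
    by move: i Pi; apply: psumr_eq0P => // i _; apply: sqr_ge0.
  by rewrite Y0 mulr0 /p big1 ?expr0n // => i /y0->; rewrite mulr0.
have Y_gt0 : 0 < Y by rewrite lt_def Y_neq0.
(* This sum expands to [Y * (X * Y - p ^+ 2)]; scaling by [Y] avoids division. *)
have : 0 <= \sum_(i | P i) (Y * x i - p * y i) ^+ 2.
  by apply: sumr_ge0 => i _; apply: sqr_ge0.
rewrite (eq_bigr (fun i => Y ^+ 2 * x i ^+ 2 + ((- (2 * Y * p)) * (x i * y i)
   + p ^+ 2 * y i ^+ 2))); last by move=> i _; ring.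
rewrite !big_split /= -!mulr_sumr -/X -/Y -/p.
have -> : Y ^+ 2 * X + (- (2 * Y * p) * p + p ^+ 2 * Y) = Y * (X * Y - p ^+ 2).
  by ring.
by rewrite pmulr_rge0 // subr_ge0.
Qed.

Section RealSums.
Variables (R : realType) (I : finType).
Implicit Types (a : I -> R) (A B S T : {set I}) (f : {set I} -> R).

Lemma sum_le_sqrt_card_l2 (s : nat) a A :
  (#|A| <= s)%N ->
  \sum_(i in A) a i <= Num.sqrt s%:R * Num.sqrt (\sum_(i in A) a i ^+ 2).
Proof.
move=> cA; rewrite -sqrtrM ?ler0n //.
apply: le_trans (ler_norm _) _; rewrite -sqrtr_sqr ler_wsqrtr //.
have := sum_CauchySchwarz (mem A) (fun=> 1) a.
under eq_bigr do rewrite mul1r.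
move=> /le_trans; apply; apply: ler_wpM2r.
  by apply: sumr_ge0 => i _; apply: sqr_ge0.
by under eq_bigr do rewrite expr1n; rewrite sumr_const ler_nat.
Qed.

(* Expanding [(a i - m) * (M - a i) >= 0] bounds the sum of squares by a
   linear function of the sum, which lies below a parabola. *)
Lemma sqrt_lifting (s : nat) a B (m M : R) :
  (0 < s)%N -> 0 <= m -> m <= M ->
  (forall i, i \in B -> m <= a i <= M) -> (#|B| == s) || (m == 0) ->
  Num.sqrt (\sum_(i in B) a i ^+ 2)
    <= (\sum_(i in B) a i) / Num.sqrt s%:R + Num.sqrt s%:R / 4 * (M - m).
Proof.
move=> s_gt0 m_ge0 mM aB cB.
set X := \sum_(i in B) a i; set r := Num.sqrt s%:R.
have r_gt0 : 0 < r by rewrite sqrtr_gt0 ltr0n.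
have r2 : r ^+ 2 = s%:R by rewrite sqr_sqrtr ?ler0n.
have X_ge0 : 0 <= X by apply: sumr_ge0 => i /aB/andP[+ _]; apply: le_trans.
have sumsq : \sum_(i in B) a i ^+ 2 <= (M + m) * X - r ^+ 2 * (m * M).
  (* Either [B] has exactly [s] elements, or [m = 0] and both sides vanish. *)
  have -> : r ^+ 2 * (m * M) = \sum_(i in B) m * M.
    rewrite sumr_const r2 mulr_natl.
    by case/orP: cB => /eqP->; rewrite ?mul0r ?mul0rn.
  rewrite mulr_sumr -sumrB; apply: ler_sum => i /aB/andP[mi iM].
  rewrite -subr_ge0.
  have -> : (M + m) * a i - m * M - a i ^+ 2 = (a i - m) * (M - a i) by ring.
  by rewrite mulr_ge0 // subr_ge0.
have rhs_ge0 : 0 <= X / r + r / 4 * (M - m).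
  by rewrite addr_ge0 ?divr_ge0 ?mulr_ge0 ?invr_ge0 ?subr_ge0 // ltW.
rewrite -(ger0_norm rhs_ge0) -sqrtr_sqr ler_wsqrtr //.
apply: le_trans sumsq _; rewrite -subr_ge0.
set x := X / r ^+ 2.
have -> : X = r ^+ 2 * x by rewrite /x mulrC divfK // expf_neq0 // gt_eqF.
(* Completing the square in [x]: the slack [r / 4 * (M - m)] leaves the nonnegative remainder
   [(M - m) * m / 2]. *)
have -> : (r ^+ 2 * x / r + r / 4 * (M - m)) ^+ 2
    - ((M + m) * (r ^+ 2 * x) - r ^+ 2 * (m * M))
  = r ^+ 2 * ((x - (M + 3 * m) / 4) ^+ 2 + (M - m) * m / 2).
  by field; rewrite gt_eqF.
rewrite mulr_ge0 ?sqr_ge0 // addr_ge0 ?sqr_ge0 //.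
by rewrite mulr_ge0 ?invr_ge0 // mulr_ge0 // subr_ge0.
Qed.

(** Greedy selection: each step moves a largest remaining term into [B], and its value becomes the
    threshold [m]. *)
Lemma top_subset (k : nat) a A (M : R) :
  (k <= #|A|)%N -> 0 <= M -> (forall i, i \in A -> 0 <= a i <= M) ->
  exists B (m : R), [/\ B \subset A, #|B| = k, 0 <= m <= M,
    forall i, i \in B -> m <= a i & forall i, i \in A :\: B -> a i <= m].
Proof.
move=> kA M_ge0 aA; elim: k kA => [_ | k IHk kA].
  exists set0, M; split; rewrite ?sub0set ?cards0 ?M_ge0 ?lexx //.
    by move=> i; rewrite inE.
  by move=> i; rewrite setD0 => /aA/andP[].
have [B [m [BA cB mM mB mA]]] := IHk (ltnW kA).
have /card_gt0P[i0 i0P] : (0 < #|A :\: B|)%N.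
  by rewrite cardsD (setIidPr BA) cB subn_gt0.
case: (arg_maxP a i0P) => x xAB x_max.
have /setDP[xA xB] := xAB.
exists (x |: B), (a x); split.
- by rewrite subUset sub1set xA.
- by rewrite cardsU1 xB cB.
- exact: aA.
- move=> i /setU1P[-> // | iB]; apply: le_trans (mA _ xAB) (mB _ iB).
- by move=> i; rewrite !inE negb_or -andbA => /and3P[_ iB iA]; apply: x_max; apply/setDP.
Qed.

(** Outside the common part, the terms of [S] are at most [m], those of [T] are at least [m], and
    [T] has at least as many of them. *)
Lemma sum_top_subset a S T (m : R) :
  (#|S| <= #|T|)%N -> 0 <= m -> (forall i, i \in T -> m <= a i) ->
  (forall i, i \in ~: T -> a i <= m) ->
  \sum_(i in S) a i <= \sum_(i in T) a i.
Proof.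
move=> cST m_ge0 aT aTC.
rewrite (big_setID T) [leRHS](big_setID S) /= setIC lerD2l.
apply: (@le_trans _ _ (\sum_(i in S :\: T) m)).
  by apply: ler_sum => i /setDP[_ iT]; apply: aTC; rewrite inE.
apply: (@le_trans _ _ (\sum_(i in T :\: S) m)).
  rewrite !sumr_const -[leLHS]mulr_natr -[leRHS]mulr_natr ler_wpM2l //.
  by rewrite ler_nat !cardsD setIC leq_sub2r.
by apply: ler_sum => i /setDP[iT _]; apply: aT.
Qed.

(** Abstracts the behaviour of the modulus of the inner product of a fixed vector with
    [Phi (restrict_mx A H)], as a function of [A]. *)
Definition disjoint_subadditive f :=
  f set0 = 0 /\
  forall A B, [disjoint A & B] -> f (A :|: B) <= f A + f B.

Lemma subadditive_le_sum f A :
  disjoint_subadditive f -> f A <= \sum_(i in A) f [set i].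
Proof.
move=> [f0 fU]; have [k] := ubnP #|A|; elim: k A => // k IHk A; rewrite ltnS => Ak.
have [-> | [x xA]] := set_0Vmem A; first by rewrite f0 big_set0.
rewrite -(setD1K xA) big_setU1 ?setD11 //=.
apply: le_trans (fU _ _ _) _; first by rewrite disjoints1 setD11.
by rewrite lerD2l IHk // (leq_trans _ Ak) // [ltnRHS](cardsD1 x) xA.
Qed.

(* Peel off blocks of the [s] largest remaining terms: the differences
   [M - m] in [sqrt_lifting] telescope. *)
Lemma subadditive_block_bound (s : nat) a f (c : R) :
  (0 < s)%N -> (forall i, 0 <= a i) -> 0 <= c -> disjoint_subadditive f ->
  forall A (M : R), 0 <= M -> (forall i, i \in A -> a i <= M) ->
  (forall B, B \subset A -> (#|B| <= s)%N ->
     f B <= c * Num.sqrt (\sum_(i in B) a i ^+ 2)) ->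
  f A <= c * ((\sum_(i in A) a i) / Num.sqrt s%:R + Num.sqrt s%:R / 4 * M).
Proof.
move=> s_gt0 a_ge0 c_ge0 [f0 fU] A.
have [k] := ubnP #|A|; elim: k A => // k IHk A; rewrite ltnS => Ak M M_ge0 aM fB.
have [As | /ltnW sA] := leqP #|A| s.
  apply: le_trans (fB _ (subxx _) As) _; rewrite ler_wpM2l //.
  (* The last block may have fewer than [s] terms; the lower threshold 0 makes [sqrt_lifting] apply
     all the same. *)
  rewrite -[M in leRHS]subr0; apply: sqrt_lifting => //; last by rewrite eqxx orbT.
  by move=> i iA; rewrite a_ge0 aM.
have aA i : i \in A -> 0 <= a i <= M by move=> iA; rewrite a_ge0 aM.
have [B [m [BA cB /andP[m_ge0 mM] mB mA]]] := top_subset sA M_ge0 aA.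
have AB : [disjoint B & A :\: B] by rewrite -setI_eq0 setIDA setDIl setDv set0I.
rewrite -[in leLHS](setID A B) (big_setID B) /= (setIidPr BA).
apply: le_trans (fU _ _ AB) _.
have fB1 : f B <= c * ((\sum_(i in B) a i) / Num.sqrt s%:R
                       + Num.sqrt s%:R / 4 * (M - m)).
  apply: le_trans (fB _ BA _) _; rewrite ?cB // ler_wpM2l //.
  apply: sqrt_lifting; rewrite ?cB ?eqxx // => i iB.
  by rewrite mB //= aM // (subsetP BA).
have fAB : f (A :\: B) <= c * ((\sum_(i in A :\: B) a i) / Num.sqrt s%:R
                       + Num.sqrt s%:R / 4 * m).
  apply: IHk => //; last by move=> C /subset_trans CA; apply/fB/CA/subsetDl.
  apply: leq_trans Ak.
  by rewrite cardsD (setIidPr BA) cB ltn_subrL s_gt0 (leq_trans s_gt0).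
apply: le_trans (lerD fB1 fAB) _.
by rewrite le_eqVlt; apply/orP; left; apply/eqP; ring.
Qed.
End RealSums.

(** * Inner product and Euclidean norm *)

Section Inner.
Variables (R : realType) (k : nat).
Implicit Types x y z : 'cV[R]_k.

Lemma innerDr x y z : inner x (y + z) = inner x y + inner x z.
Proof. by rewrite /inner -big_split; apply: eq_bigr => i _; rewrite mxE mulrDr. Qed.

Lemma inner0r x : inner x 0 = 0.
Proof. by rewrite /inner big1 // => i _; rewrite mxE mulr0. Qed.

Lemma norm2_sqr x : norm2 x ^+ 2 = inner x x.
Proof. by rewrite sqr_sqrtr // sumr_ge0 // => i _; apply: sqr_ge0. Qed.

Lemma norm2_ge0 x : 0 <= norm2 x.
Proof. exact: sqrtr_ge0. Qed.

Lemma inner_le_norm2 x y : inner x y <= norm2 x * norm2 y.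
Proof.
have sq_ge0 z : 0 <= \sum_i z i 0 ^+ 2 by apply: sumr_ge0 => i _; apply: sqr_ge0.
rewrite /norm2 -sqrtrM //; apply: le_trans (ler_norm _) _.
by rewrite -sqrtr_sqr ler_wsqrtr //; apply: sum_CauchySchwarz.
Qed.
End Inner.

(** * Restricted matrices: supports, column norms, sparsity *)

Section Restrict.
Variables (R : realType) (n : nat) (H : 'M[R]_n).
Implicit Types (A B : {set 'I_n * 'I_n}) (T : {set 'I_n}).

Lemma restrict_mx0 : restrict_mx set0 H = 0.
Proof. by apply/matrixP => i j; rewrite !mxE inE. Qed.

Lemma restrict_mxU A B : [disjoint A & B] ->
  restrict_mx (A :|: B) H = restrict_mx A H + restrict_mx B H.
Proof.
rewrite -setI_eq0 => /eqP/setP AB; apply/matrixP => i j; rewrite !mxE inE.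
by have := AB (i, j); rewrite !inE; do 2!case: (_ \in _) => //=; rewrite ?addr0 ?add0r.
Qed.

Lemma restrict_mxC A : H = restrict_mx A H + restrict_mx (~: A) H.
Proof.
by apply/matrixP => i j; rewrite !mxE inE; case: (_ \in _); rewrite ?addr0 ?add0r.
Qed.

Lemma supp_restrict_mx A : supp (restrict_mx A H) \subset A.
Proof.
apply/subsetP => -[i j]; rewrite inE mxE /=; case: ifP => //.
by rewrite eqxx.
Qed.

Lemma norm1_col_restrict_mx A j :
  norm1 (col j (restrict_mx A H)) = \sum_(i | (i, j) \in A) `|H i j|.
Proof.
rewrite /norm1 [RHS]big_mkcond; apply: eq_bigr => i _; rewrite !mxE.
by case: ifP => // _; rewrite normr0.
Qed.

Lemma norm2_col_restrict_mx A j :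
  norm2 (col j (restrict_mx A H))
    = Num.sqrt (\sum_(i | (i, j) \in A) `|H i j| ^+ 2).
Proof.
congr Num.sqrt; rewrite [RHS]big_mkcond; apply: eq_bigr => i _; rewrite !mxE.
by case: ifP => // _; rewrite ?expr0n // real_normK ?num_real.
Qed.

Lemma norm2_col_restrict_setX T j k :
  norm2 (col k (restrict_mx (setX T [set j]) H))
    = if k == j then Num.sqrt (\sum_(i in T) `|H i j| ^+ 2) else 0.
Proof.
rewrite norm2_col_restrict_mx; case: eqP => [-> | /eqP/negPf kj].
  by congr Num.sqrt; apply: eq_bigl => i; rewrite !inE eqxx andbT.
by rewrite big1 ?sqrtr0 // => i; rewrite !inE kj andbF.
Qed.

Lemma normF_sqr_restrict_setX T j :
  normF (restrict_mx (setX T [set j]) H) ^+ 2 = \sum_(i in T) `|H i j| ^+ 2.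
Proof.
rewrite sqr_sqrtr; last first.
  by apply: sumr_ge0 => i _; apply: sumr_ge0 => k _; apply: sqr_ge0.
rewrite [RHS]big_mkcond; apply: eq_bigr => i _; rewrite (bigD1 j) //= big1 => [|k].
  rewrite addr0 mxE !inE eqxx andbT; case: ifP; rewrite ?expr0n // => _.
  by rewrite real_normK ?num_real.
by rewrite mxE !inE => /negPf->; rewrite andbF expr0n.
Qed.

Lemma col_sparse_restrict_setX s T j :
  (#|T| <= s)%N -> col_sparse s (restrict_mx (setX T [set j]) H).
Proof.
move=> cT k; apply: leq_trans cT; apply/subset_leq_card/subsetP => i.
by rewrite !inE mxE !inE; case: (i \in T) => //=; rewrite eqxx.
Qed.
End Restrict.

(** * Estimates in a single column *)

Section Column.
Variables (R : realType) (n m s : nat) (Phi : {linear 'M[R]_n -> 'cV[R]_m}).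
Variables (delta Delta : R).
Hypotheses (s_gt0 : (0 < s)%N) (delta_gt0 : 0 < delta) (delta_lt1 : delta < 1).
Hypothesis Delta_gt0 : 0 < Delta.
Hypothesis HRIP : forall Z : 'M[R]_n, col_sparse s Z ->
  (1 - delta) * normF Z ^+ 2 <= norm2 (Phi Z) ^+ 2
  /\ norm2 (Phi Z) ^+ 2 <= (1 + delta) * normF Z ^+ 2.
Hypothesis Hortho : forall Z W : 'M[R]_n, col_sparse s Z -> col_sparse s W ->
  supp Z :&: supp W = set0 ->
  `|inner (Phi Z) (Phi W)|
    <= Delta / n%:R * \sum_j norm2 (col j Z) * norm2 (col j W).
Variables (H : 'M[R]_n) (j : 'I_n).

Let l2 (T : {set 'I_n}) : R := Num.sqrt (\sum_(i in T) `|H i j| ^+ 2).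
Let l1 (T : {set 'I_n}) : R := \sum_(i in T) `|H i j|.
Let blk (T : {set 'I_n}) (k : 'I_n) : 'M[R]_n := restrict_mx (setX T [set k]) H.

Let f (T : {set 'I_n}) (A : {set 'I_n * 'I_n}) : R :=
   `|inner (Phi (blk T j)) (Phi (restrict_mx A H))|.

Let f_sub T : disjoint_subadditive (f T).
Proof.
split=> [|A B AB]; rewrite /f; first by rewrite restrict_mx0 linear0 inner0r normr0.
by rewrite restrict_mxU // linearD innerDr ler_normD.
Qed.

(** Hypothesis (2) applies since the supports are disjoint. In its sum over columns only column [j]
    of [blk T j] survives, so blocks in different columns have orthogonal images. *)
Let f_block (T B : {set 'I_n}) (k : 'I_n) : (#|T| <= s)%N ->
  (#|B| <= s)%N -> [disjoint T & B] || (k != j) ->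
  f T (setX B [set k]) <= if k == j then Delta * l2 T * l2 B else 0.
Proof.
move=> cT cB TB; apply: le_trans (Hortho _ _ _) _; try exact: col_sparse_restrict_setX.
  apply/eqP; rewrite setI_eq0.
  apply: disjointW (supp_restrict_mx _ _) (supp_restrict_mx _ _) _.
  rewrite -setI_eq0; apply/eqP/setP => -[i l]; rewrite !inE /=.
  case/orP: TB => [/pred0P/(_ i)/= | kj].
    by case: (i \in T) => //= ->; rewrite andbF.
  by case: eqP => [-> | _]; rewrite ?andbF // eq_sym (negPf kj) !andbF.
rewrite (bigD1 j) //= big1 => [|l lj]; last first.
  by rewrite [X in X * _]norm2_col_restrict_setX (negPf lj) mul0r.
rewrite addr0 /blk !norm2_col_restrict_setX eqxx eq_sym.
case: eqP => [-> | _]; last first.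
  by rewrite !mulr0.
rewrite mulrA ler_wpM2r ?sqrtr_ge0 // ler_wpM2r ?sqrtr_ge0 //.
(* The factor [1 / n] is bounded by 1; [n] is positive because the index [j] exists. *)
have n_gt0 : (0 < n)%N by apply: leq_trans (ltn_ord j).
by rewrite ler_pdivrMr ?ltr0n // ler_peMr ?ler1n // ltW.
Qed.

(** Shared by both choices of blocks: [u] stands for a bound on the sum of the l2-norms of the
    blocks covering the rest of column [j]. Pairing [Phi (blk T j)] with [Phi H] bounds
    [norm2 (Phi (blk T j)) ^+ 2]; both sides of (1) then turn this into a multiple of [l2 T], which
    cancels. *)
Lemma column_bound (T : {set 'I_n}) (u : R) : (#|T| <= s)%N ->
  f T (setX (~: T) [set j]) <= Delta * l2 T * u -> 0 <= u ->
  (1 - delta) * l2 T <= Num.sqrt (1 + delta) * norm2 (Phi H) + Delta * u.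
Proof.
move=> cT fu u_ge0.
have Z_sp : col_sparse s (blk T j) by apply: col_sparse_restrict_setX.
have [lo up] := HRIP Z_sp.
have l2_ge0 : 0 <= l2 T by apply: sqrtr_ge0.
have l2_sqr : l2 T ^+ 2 = normF (blk T j) ^+ 2.
  rewrite normF_sqr_restrict_setX sqr_sqrtr //.
  by apply: sumr_ge0 => i _; apply: sqr_ge0.
rewrite -l2_sqr in lo up.
have up1 : norm2 (Phi (blk T j)) <= Num.sqrt (1 + delta) * l2 T.
  rewrite -[l2 T]ger0_norm // -sqrtr_sqr -sqrtrM; last by rewrite addr_ge0 // ltW.
  rewrite -[leLHS]ger0_norm ?norm2_ge0 // -sqrtr_sqr ler_wsqrtr //.
have fC : f T (~: setX T [set j]) <= Delta * l2 T * u.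
  (* The other columns contribute 0, entry by entry; only the rest of column [j] remains. *)
  have -> : ~: setX T [set j] = [set p | p.2 != j] :|: setX (~: T) [set j].
    by apply/setP => -[i l]; rewrite !inE /=; case: (i \in T); case: eqP.
  apply: le_trans ((f_sub T).2 _ _ _) _.
    rewrite -setI_eq0; apply/eqP/setP => -[i l]; rewrite !inE /=.
    by case: eqP; rewrite ?andbF.
  rewrite -[leRHS]add0r lerD //; apply: le_trans (subadditive_le_sum _ (f_sub T)) _.
  apply: sumr_le0 => -[i l]; rewrite inE /= => lj.
  have -> : [set (i, l)] = setX [set i] [set l].
    by apply/setP => -[i' l']; rewrite !inE.
  by have := @f_block T [set i] l cT; rewrite cards1 lj orbT (negPf lj); apply.
have PhiZ_sqr : norm2 (Phi (blk T j)) ^+ 2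
    <= norm2 (Phi (blk T j)) * norm2 (Phi H) + Delta * l2 T * u.
  apply: (@le_trans _ _ (inner (Phi (blk T j)) (Phi H) + f T (~: setX T [set j]))).
    rewrite norm2_sqr [in leRHS](restrict_mxC H (setX T [set j])) linearD innerDr.
    rewrite -addrA lerDl -lerBlDl sub0r /f.
    by rewrite -normrN ler_norm.
  by rewrite lerD // inner_le_norm2.
have := le_trans lo PhiZ_sqr.
have : norm2 (Phi (blk T j)) * norm2 (Phi H)
     <= Num.sqrt (1 + delta) * l2 T * norm2 (Phi H) by rewrite ler_wpM2r ?norm2_ge0.
move=> h1 h2.
have rhs_ge0 : 0 <= Num.sqrt (1 + delta) * norm2 (Phi H) + Delta * u.
  by rewrite addr_ge0 ?mulr_ge0 ?sqrtr_ge0 ?norm2_ge0 // ltW.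
have [-> | q_neq0] := eqVneq (l2 T) 0; first by rewrite mulr0.
have q_gt0 : 0 < l2 T by rewrite lt_def q_neq0.
rewrite -(ler_pM2r q_gt0); move: h1 h2; lra.
Qed.

(** Blocks of single entries: their l2-norms sum to [l1 (~: T)] with no [l2 T] term, so positivity
    of [1 - delta] suffices. *)
Lemma column_null_space_crude (T : {set 'I_n}) : (#|T| <= s)%N ->
  l1 T <= Num.sqrt s%:R * Delta / (1 - delta) * l1 (~: T)
          + Num.sqrt s%:R * Num.sqrt (1 + delta) / (1 - delta) * norm2 (Phi H).
Proof.
move=> cT.
have l1_ge0 : 0 <= l1 (~: T) by apply: sumr_ge0.
have d_gt0 : 0 < 1 - delta by rewrite subr_gt0.
have := @column_bound T (l1 (~: T)) cT.
have fT : f T (setX (~: T) [set j]) <= Delta * l2 T * l1 (~: T).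
  apply: le_trans (subadditive_le_sum _ (f_sub T)) _.
  rewrite mulr_sumr (reindex_onto (fun i => (i, j)) fst) /=; last first.
    by move=> [i l]; rewrite !inE /= => /andP[_ /eqP->].
  rewrite [leRHS]big_mkcond [leLHS]big_mkcond; apply: ler_sum => i _.
  rewrite !inE !eqxx !andbT; case: ifP => // iT.
  have -> : [set (i, j)] = setX [set i] [set j].
    by apply/setP => -[i' l']; rewrite !inE.
  have := @f_block T [set i] j cT; rewrite cards1 eqxx orbF disjoint_sym disjoints1 iT.
  move=> /(_ s_gt0 isT) /le_trans; apply.
  by rewrite /l2 big_set1 sqrtr_sqr normr_id.
move=> /(_ fT l1_ge0) bound; apply: le_trans (sum_le_sqrt_card_l2 _ cT) _.
rewrite -/(l2 T).
have -> : Num.sqrt s%:R * Delta / (1 - delta) * l1 (~: T)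
    + Num.sqrt s%:R * Num.sqrt (1 + delta) / (1 - delta) * norm2 (Phi H)
  = Num.sqrt s%:R * ((Num.sqrt (1 + delta) * norm2 (Phi H) + Delta * l1 (~: T))
                     / (1 - delta)).
  by field; rewrite gt_eqF.
by rewrite ler_wpM2l ?sqrtr_ge0 // ler_pdivlMr // mulrC.
Qed.

Lemma column_null_space (S : {set 'I_n}) : (#|S| <= s)%N ->
  0 < 1 - delta - Delta / 4 ->
  l1 S <= Delta / (1 - delta - Delta / 4) * l1 (~: S)
          + Num.sqrt s%:R * Num.sqrt (1 + delta) / (1 - delta - Delta / 4)
            * norm2 (Phi H).
Proof.
move=> cS D_gt0; set D := 1 - delta - Delta / 4 in D_gt0 *.
set r := Num.sqrt s%:R.
have r_gt0 : 0 < r by rewrite sqrtr_gt0 ltr0n.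
have h_le i : i \in [set: 'I_n] -> 0 <= `|H i j| <= l1 setT.
  by move=> iT; rewrite normr_ge0 /l1 (bigD1 i) //= lerDl sumr_ge0.
have l1T_ge0 : 0 <= l1 setT by apply: sumr_ge0.
(* [T] has [minn s n] elements because a column may be shorter than [s]; [l1 setT] is just some
   upper bound for its entries. *)
have [|T [M [_ cT /andP[M_ge0 _] MT TM]]] :=
    @top_subset _ _ (minn s n) (fun i => `|H i j|) setT (l1 setT) _ l1T_ge0 h_le.
  by rewrite cardsT card_ord geq_minr.
rewrite setTD in TM.
have cTs : (#|T| <= s)%N by rewrite cT geq_minl.
have cST : (#|S| <= #|T|)%N.
  by rewrite cT leq_min cS -[n in (_ <= n)%N]card_ord max_card.
have ST : l1 S <= l1 T by apply: sum_top_subset MT TM.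
have l1C A : l1 (~: A) = l1 setT - l1 A.
  by rewrite /l1 [in RHS](big_setID A) /= setTI setTD addrC addrK.
have TSC : l1 (~: T) <= l1 (~: S) by rewrite !l1C lerD2l lerN2.
have l1TC_ge0 : 0 <= l1 (~: T) by apply: sumr_ge0.
have l2_ge0 : 0 <= l2 T by apply: sqrtr_ge0.
have u_ge0 : 0 <= l1 (~: T) / r + l2 T / 4.
  by rewrite addr_ge0 ?divr_ge0 // ltW.
have fT : f T (setX (~: T) [set j]) <= Delta * l2 T * (l1 (~: T) / r + l2 T / 4).
  (* If [n <= s], then [T] is the whole column and no block remains. *)
  have [ns | /ltnW sn] := leqP n s.
    have -> : setX (~: T) [set j] = set0.
      have -> : T = setT.
        apply/eqP; rewrite eqEcard subsetT cardsT card_ord cT.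
        by rewrite (minn_idPr ns) leqnn.
      by apply/setP => -[i l]; rewrite !inE.
    by rewrite (f_sub _).1 (mulr_ge0 _ u_ge0) // mulr_ge0 ?sqrtr_ge0 // ltW.
  (* All [s] entries in [T] are at least [M]; this turns the telescoped term [r / 4 * M] into
     [l2 T / 4]. *)
  have rM : r * M <= l2 T.
    rewrite -[M]ger0_norm // -sqrtr_sqr -sqrtrM ?ler0n // ler_wsqrtr //.
    rewrite mulr_natl -[in leLHS](minn_idPl sn) -cT -sumr_const.
    by apply: ler_sum => i iT; rewrite lerXn2r ?nnegrE ?normr_ge0 ?MT.
  have g_sub : disjoint_subadditive (fun A => f T (setX A [set j])).
    split=> [|A B AB].
      have -> : setX set0 [set j] = set0 :> {set 'I_n * 'I_n}.
        by apply/setP => -[i l]; rewrite !inE.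
      exact: (f_sub T).1.
    have -> : setX (A :|: B) [set j] = setX A [set j] :|: setX B [set j].
      by apply/setP => -[i l]; rewrite !inE /= andb_orl.
    apply: (f_sub T).2; move: AB; rewrite -!setI_eq0 => /eqP/setP AB.
    apply/eqP/setP => -[i l]; have := AB i; rewrite !inE /=.
    by case: (i \in A) => //= ->; rewrite andbF.
  apply: le_trans (@subadditive_block_bound _ _ s (fun i => `|H i j|) _
      (Delta * l2 T) s_gt0 _ _ g_sub _ M M_ge0 TM _) _ => //.
  - by rewrite mulr_ge0 // ltW.
  - move=> B BT cB; have := @f_block T B j cTs cB; rewrite eqxx orbF; apply.
    by rewrite disjoint_sym disjoints_subset.
  - apply: ler_wpM2l; first by rewrite mulr_ge0 // ltW.
    by rewrite lerD2l mulrAC ler_wpM2r ?invr_ge0.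
have bound := column_bound cTs fT u_ge0.
apply: le_trans ST (le_trans (sum_le_sqrt_card_l2 _ cTs) _); rewrite -/(l2 T) -/r.
apply: (@le_trans _ _ (Delta / D * l1 (~: T)
                       + r * Num.sqrt (1 + delta) / D * norm2 (Phi H))); last first.
  by rewrite lerD2r ler_wpM2l // divr_ge0 // ltW.
have -> : Delta / D * l1 (~: T) + r * Num.sqrt (1 + delta) / D * norm2 (Phi H)
  = r * ((Num.sqrt (1 + delta) * norm2 (Phi H) + Delta * (l1 (~: T) / r)) / D).
  by field; rewrite !gt_eqF.
(* Moving [Delta * (l2 T / 4)] to the left of [bound] turns the factor [1 - delta] into [D]. *)
rewrite ler_pM2l // ler_pdivlMr // /D; move: bound; lra.
Qed.
End Column.

(** * From columns to matrices, and the choice of constants *)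

Lemma null_space_ineq_of_columns (R : realType) (n m s : nat)
    (Phi : 'M[R]_n -> 'cV[R]_m) (rho beta : R) :
  0 <= rho -> 0 <= beta ->
  (forall (H : 'M[R]_n) (j : 'I_n) (S : {set 'I_n}), (#|S| <= s)%N ->
     \sum_(i in S) `|H i j| <= rho * (\sum_(i in ~: S) `|H i j|)
                               + beta * norm2 (Phi H)) ->
  null_space_ineq s Phi rho beta.
Proof.
move=> rho_ge0 beta_ge0 colP H S Ssp.
have max_ge0 (Z : 'M[R]_n) : 0 <= maxcol_norm1 Z by apply: bigmax_ge_id.
apply/bigmax_leP; split=> [|j _].
  (* The starting value 0 of the maximum must lie below the right-hand side too. *)
  by rewrite addr_ge0 ?mulr_ge0 ?norm2_ge0.
have := colP H j [set i | (i, j) \in S] (Ssp j).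
rewrite norm1_col_restrict_mx => colS.
apply: (@le_trans _ _ (rho * norm1 (col j (restrict_mx (~: S) H))
                       + beta * norm2 (Phi H))); last first.
  rewrite lerD2r ler_wpM2l //.
  exact: (le_bigmax 0 (fun j => norm1 (col j (restrict_mx (~: S) H)))).
rewrite norm1_col_restrict_mx; move: colS.
rewrite (eq_bigl (fun i => (i, j) \in S)) => [|i]; last by rewrite inE.
by rewrite [X in rho * X + _](eq_bigl (fun i => (i, j) \in ~: S)) // => i; rewrite !inE.
Qed.

Theorem theorem3p5 (R : realType) (n m s : nat)
    (Phi : {linear 'M[R]_n -> 'cV[R]_m}) (delta Delta : R)
    (s_gt0 : (0 < s)%N)
    (delta_gt0 : 0 < delta) (delta_lt1 : delta < 1) (Delta_gt0 : 0 < Delta)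
    (HRIP : forall Z : 'M[R]_n, col_sparse s Z ->
       (1 - delta) * normF Z ^+ 2 <= norm2 (Phi Z) ^+ 2
       /\ norm2 (Phi Z) ^+ 2 <= (1 + delta) * normF Z ^+ 2)
    (Hortho : forall Z W : 'M[R]_n, col_sparse s Z -> col_sparse s W ->
       supp Z :&: supp W = set0 ->
       `|inner (Phi Z) (Phi W)|
         <= Delta / n%:R * \sum_j norm2 (col j Z) * norm2 (col j W)) :
  (exists rho beta : R,
     null_space_ineq s Phi rho beta
     /\ (0 < 1 - delta - Delta / 4 ->
         rho <= Delta / (1 - delta - Delta / 4)
         /\ beta <= Num.sqrt s%:R * Num.sqrt (1 + delta)
                    / (1 - delta - Delta / 4)))
  /\ (delta + 5 * Delta / 4 < 1 ->
      exists rho beta : R,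
        [/\ null_space_ineq s Phi rho beta,
            rho <= Delta / (1 - delta - Delta / 4),
            beta <= Num.sqrt s%:R * Num.sqrt (1 + delta)
                    / (1 - delta - Delta / 4)
          & rho < 1]).
Proof.
have sharp : 0 < 1 - delta - Delta / 4 ->
    null_space_ineq s Phi (Delta / (1 - delta - Delta / 4))
      (Num.sqrt s%:R * Num.sqrt (1 + delta) / (1 - delta - Delta / 4)).
    move=> D_gt0; apply: null_space_ineq_of_columns => [||H j S cS].
    - by rewrite divr_ge0 // ltW.
    - by rewrite divr_ge0 ?mulr_ge0 ?sqrtr_ge0 // ltW.
    - exact: column_null_space.
split=> [|dD].
  have [D_gt0 | D_le0] := ltP 0 (1 - delta - Delta / 4).
    by do 2!eexists; split; [exact: sharp | move=> _; split].
  (* Here the premise of the bounds on [rho] and [beta] fails, so the larger constants from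
     single-entry blocks will do. *)
  exists (Num.sqrt s%:R * Delta / (1 - delta)),
    (Num.sqrt s%:R * Num.sqrt (1 + delta) / (1 - delta)); split; last by [].
  have d_ge0 : 0 <= 1 - delta by rewrite subr_ge0 ltW.
  apply: null_space_ineq_of_columns => [||H j S cS].
  - by rewrite divr_ge0 // mulr_ge0 ?sqrtr_ge0 // ltW.
  - by rewrite divr_ge0 ?mulr_ge0 ?sqrtr_ge0.
  - exact: column_null_space_crude.
(* Splitting [5 * Delta / 4] as [Delta + Delta / 4] shows that the assumption says exactly that the
   sharp [rho] is below 1. *)
have D_gt : Delta < 1 - delta - Delta / 4 by lra.
have D_gt0 := lt_trans Delta_gt0 D_gt.
do 2!eexists; split; [exact: sharp | exact: lexx | exact: lexx |].
by rewrite ltr_pdivrMr // mul1r.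
Qed.
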